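(* Let $G=(V,E)$ be a finite graph and let $\mathbf J,\tilde{\mathbf J}$ be ferromagnetic pair interactions on $G$ with $0\le J_{uv}\le\tilde J_{uv}$ for every $uv\in E$. Let $(\lambda_u)_{u\in V}$ be nonnegative real numbers. Let $\alpha_1(\mathbf J)$ (resp. $\alpha_1(\tilde{\mathbf J})$) be the smallest modulus of a zero of the entire function $h\mapsto\big\langle\exp\big[h\sum_{u\in V}\lambda_u\sigma_u\big]\big\rangle_{G,\mathbf J}$, $h\in\mathbb C$ (resp. of the same function with $\tilde{\mathbf J}$ in place of $\mathbf J$), with the convention that it is $+\infty$ if there is no zero. Then $\alpha_1(\mathbf J)\ge\alpha_1(\tilde{\mathbf J})$.
   Context: The Ising model on a finite graph $G=(V,E)$ with interactions $\mathbf J=(J_{uv})_{uv\in E}$, $J_{uv}\ge 0$, is the probability measure on $\{-1,+1\}^V$ given by $\mathbb P_{G,\mathbf J}(\sigma)=\exp\big[\sum_{uv\in E}J_{uv}\sigma_u\sigma_v\big]/Z_G$, where $Z_G$ is the normalizing constant; $\langle\cdot\rangle_{G,\mathbf J}$ denotes expectation with respect to it. *)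

(* Defs.v *)
From HB Require Import structures.
From mathcomp Require Import all_boot all_order all_algebra.
From mathcomp Require Import all_classical all_reals.
From mathcomp Require Import all_analysis.
From mathcomp Require Import complex.

Set Implicit Arguments.
Unset Strict Implicit.
Unset Printing Implicit Defensive.

Import Order.TTheory GRing.Theory Num.Theory.
Local Open Scope ring_scope.

Section Ising.
Variable R : realType.
Variable V : finType.

Definition spin (b : bool) : R := if b then 1 else -1.

Definition simple_graph (E : {set {set V}}) : Prop :=
  forall e, e \in E -> #|e| = 2%N.

(* Hamiltonian  sum_{uv in E} J_uv sigma_u sigma_v
   (for e = {u,v}, \prod_(u in e) spin (s u) = sigma_u sigma_v) *)
Definition ising_energy (E : {set {set V}}) (J : {set V} -> R)
  (s : {ffun V -> bool}) : R :=
  \sum_(e in E) J e * \prod_(u in e) spin (s u).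

Definition ising_Z (E : {set {set V}}) (J : {set V} -> R) : R :=
  \sum_(s : {ffun V -> bool}) expR (ising_energy E J s).

Definition cexp (z : R[i]) : R[i] :=
  ((expR (complex.Re z) * cos (complex.Im z)) +i* (expR (complex.Re z) * sin (complex.Im z)))%C.

Definition ising_mgf (E : {set {set V}}) (J : {set V} -> R)
  (lambda : V -> R) (h : R[i]) : R[i] :=
  (\sum_(s : {ffun V -> bool})
      (expR (ising_energy E J s))%:C%C *
      cexp (h * (\sum_(u : V) lambda u * spin (s u))%:C%C))
  / (ising_Z E J)%:C%C.

(* alpha_1: smallest modulus of a zero (infimum; +oo if no zero) *)
Definition alpha1 (E : {set {set V}}) (J : {set V} -> R) (lambda : V -> R)
  : \bar R :=
  ereal_inf [set ((Normc.normc h)%:E) | h in [set h | ising_mgf E J lambda h = 0]].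

End Ising.

(* Main.v *)
(** By the Lee-Yang property the first zero is imaginary: [alpha1] is the first zero of
[F r = sum_s exp(energy s) cos(r M(s))], [M = sum_u lambda_u s_u].  Duplicate
the spins and put [a = (s + s')/2], [d = (s - s')/2]: at each site exactly one
of [a], [d] is nonzero, and the energy is [2 J (a a + d d)].  The field
[i r lambda] couples to [a] only, so expanding the [d]-interactions of the sites of a
monomial in [d] gives a GKS argument: a sum of such a monomial against a
function of [a] is nonnegative as soon as that function has nonnegative sums over all
sub-volumes avoiding the monomial.  Hence
- |Z(x + iy)| >= |Z(iy)| (Lee-Yang);
- the ratio of [S_u = sum s_u sin(r M)] to [F] is nondecreasing in [r], so [S_u >= 0]
  before the first zero;
- if moreover all sub-volumes are zero-free up to [r], then the ratio of
  [G_uv = sum s_u s_v cos(r M)] to [F] is nonincreasing, so [G_uv <= F] there.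
At a first zero of [F] this gives [G_uv <= 0], so [F] is nonpositive there for every
larger value of [J_uv].  An induction on the volume, where a vertex is removed by
switching off its couplings, shows that zero-freeness up to [r] passes to smaller
couplings and smaller volumes. *)

Require Import Defs.
From HB Require Import structures.
From mathcomp Require Import all_boot all_order all_algebra.
From mathcomp Require Import all_classical all_reals.
From mathcomp Require Import all_analysis.
From mathcomp Require Import complex.
From mathcomp Require Import fintype finset ring lra.
Import Order.TTheory GRing.Theory Num.Theory.
Import numFieldNormedType.Exports.
Local Open Scope ring_scope.
Set Implicit Arguments.
Unset Strict Implicit.
Unset Printing Implicit Defensive.

(** * Duplicated spins and positivity of half-difference monomials *)

Section Duplicated.
Variables (R : realType) (V : finType).
Implicit Types (A B S e : {set V}) (k : V -> nat).
Local Notation dcfg := {ffun V -> bool * bool}.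

Definition half_sum (c : dcfg) (u : V) : R := (spin R (c u).1 + spin R (c u).2) / 2.
Definition half_diff (c : dcfg) (u : V) : R := (spin R (c u).1 - spin R (c u).2) / 2.

Definition diff_monomial k (c : dcfg) : R := \prod_u half_diff c u ^+ k u.

Definition depends_on {T : Type} S (G : {ffun V -> T} -> R) :=
  forall c c' : {ffun V -> T}, {in S, c =1 c'} -> G c = G c'.

(** Exchanging the coordinates outside [S] between two independent copies is an involution on pairs.
    It brings [G] and [H] to the same configuration, and the idle copy contributes the cardinal. *)
Lemma sum_mul_independent (T : finType) S (G H : {ffun V -> T} -> R) :
  depends_on S G -> depends_on (~: S) H ->
  (\sum_c G c) * (\sum_c H c) = #|{ffun V -> T}|%:R * \sum_c G c * H c.
Proof.
move=> GS HS.
pose mix (c c' : {ffun V -> T}) : {ffun V -> T} :=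
  [ffun x => if x \in S then c x else c' x].
pose sw (p : {ffun V -> T} * {ffun V -> T}) := (mix p.1 p.2, mix p.2 p.1).
have swK : involutive sw.
  case=> c c'; rewrite /sw /=.
  by congr (_, _); apply/ffunP => x; rewrite !ffunE; case: (x \in S).
rewrite big_distrlr pair_bigA /=.
transitivity (\sum_p G (sw p).1 * H (sw p).1).
  apply: eq_bigr => -[c c'] _ /=; congr (_ * _).
    by apply: GS => x xS; rewrite ffunE xS.
  by apply: HS => x; rewrite inE ffunE => /negbTE ->.
rewrite -(reindex_inj (inv_inj swK) (P := predT) (F := fun p => G p.1 * H p.1)).
rewrite -(pair_bigA _ (fun c _ => G c * H c)) /= mulr_sumr.
by apply: eq_bigr => c _; rewrite sumr_const cardT mulr_natl -cardT.
Qed.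

Lemma card_cfg_gt0 (T : finType) (t : T) : 0 < #|{ffun V -> T}|%:R :> R.
Proof. by rewrite ltr0n; apply/card_gt0P; exists [ffun=> t]. Qed.

(** The sum factorizes over sites; at each site the four spin pairs contribute [0 ^+ k u] twice,
    [1], and [(-1) ^+ k u]. *)
Lemma sum_diff_monomial_ge0 k : 0 <= \sum_c diff_monomial k c.
Proof.
rewrite /diff_monomial.
rewrite -(bigA_distr_bigA (fun u (p : bool * bool) => ((spin R p.1 - spin R p.2) / 2) ^+ k u)).
apply: prodr_ge0 => u _.
rewrite -(pair_bigA _ (fun a b => ((spin R a - spin R b) / 2) ^+ k u)) /= !big_bool /=.
rewrite !subrr mul0r.
have -> : (1 - -1) / 2 = 1 :> R by field.
have -> : (-1 - 1) / 2 = -1 :> R by field.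
rewrite expr1n.
have h0 : 0 <= 0 ^+ k u :> R by apply: exprn_ge0.
have h1 : -1 <= (-1) ^+ k u :> R by rewrite -signr_odd; case: odd; rewrite ?expr1 ?expr0; lra.
lra.
Qed.

Lemma half_diff_cases c u :
  [\/ half_diff c u = 0, half_diff c u = 1 /\ half_sum c u = 0
    | half_diff c u = -1 /\ half_sum c u = 0].
Proof.
rewrite /half_diff /half_sum; case: (c u) => -[] [] /=; rewrite /spin /=.
- by apply: Or31; field.
- by apply: Or32; split; field.
- by apply: Or33; split; field.
- by apply: Or31; field.
Qed.

Lemma half_sum0 c u : half_diff c u != 0 -> half_sum c u = 0.
Proof. by case: (half_diff_cases c u) => [-> /eqP|[]|[]]. Qed.

Lemma prod_half_diff_cases e c :
  [\/ \prod_(u in e) half_diff c u = 0, \prod_(u in e) half_diff c u = 1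
    | \prod_(u in e) half_diff c u = -1].
Proof.
elim/big_rec: _ => [|u y _ IH]; first exact: Or32.
case: (half_diff_cases c u) => [->|[-> _]|[-> _]].
- by rewrite mul0r; apply: Or31.
- by rewrite mul1r.
- by case: IH => ->; rewrite ?mulr0 ?mulr1 ?mulrNN ?mulr1;
    [apply: Or31 | apply: Or33 | apply: Or32].
Qed.

Lemma diff_monomialD k k' c :
  diff_monomial (fun u => k u + k' u)%N c = diff_monomial k c * diff_monomial k' c.
Proof. by rewrite -big_split; apply: eq_bigr => u _; rewrite exprD. Qed.

Lemma diff_monomial_mem e c :
  diff_monomial (fun u => (u \in e) : nat) c = \prod_(u in e) half_diff c u.
Proof.
rewrite /diff_monomial [RHS]big_mkcond; apply: eq_bigr => u _.
by case: (u \in e); rewrite ?expr1 ?expr0.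
Qed.

Lemma diff_monomial_pred1 u c :
  diff_monomial (fun x => (x == u) : nat) c = half_diff c u.
Proof.
rewrite /diff_monomial (bigD1 u) //= eqxx expr1 big1 ?mulr1 // => x /negbTE ->.
by rewrite expr0.
Qed.

(** A GKS-type cone, stable under sums and under multiplication by exponentials of nonnegative
    [half_diff] interactions. *)
Definition diff_positive (Psi : dcfg -> R) :=
  forall k, 0 <= \sum_c diff_monomial k c * Psi c.

Lemma diff_positiveD Psi Psi' : diff_positive Psi -> diff_positive Psi' ->
  diff_positive (fun c => Psi c + Psi' c).
Proof.
move=> pos pos' k; under eq_bigr => c _ do rewrite mulrDr.
by rewrite big_split addr_ge0 ?pos ?pos'.
Qed.

Lemma diff_positive_expB e (t : R) Psi : 0 <= t -> diff_positive Psi ->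
  diff_positive (fun c => expR (t * \prod_(u in e) half_diff c u) * Psi c - Psi c).
Proof.
move=> t0 pos k.
set ke := fun u => (u \in e) : nat.
have ht := expR_ge1Dx t; have hNt := expR_ge1Dx (- t).
have htt : expR (- t) <= expR t by rewrite ler_expR; lra.
(* exp(t D) - 1 = sinh(t) D + (cosh(t) - 1) D^2 for D in {-1, 0, 1} *)
have -> : \sum_c diff_monomial k c *
    (expR (t * \prod_(u in e) half_diff c u) * Psi c - Psi c) =
  (expR t - expR (- t)) / 2 * (\sum_c diff_monomial (fun u => k u + ke u)%N c * Psi c) +
  ((expR t + expR (- t)) / 2 - 1) *
    (\sum_c diff_monomial (fun u => k u + (ke u + ke u))%N c * Psi c).
  rewrite !mulr_sumr -!big_split; apply: eq_bigr => c _ /=.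
  rewrite !diff_monomialD diff_monomial_mem.
  by case: (prod_half_diff_cases e c) => ->; rewrite ?mulr0 ?mulr1 ?mulrN1 ?expR0; field.
by rewrite !addr_ge0 ?mulr_ge0 ?pos //; lra.
Qed.

(** Subtracting [Psi] turns positivity into a comparison: switching on the interactions can only
    increase the sums. The Lee-Yang bound rests on this form. *)
Lemma diff_positive_exp_sumB (I : Type) (r : seq I) (P : pred I) (t : I -> R)
    (e : I -> {set V}) Psi :
  (forall i, P i -> 0 <= t i) -> diff_positive Psi ->
  diff_positive (fun c =>
    expR (\sum_(i <- r | P i) t i * \prod_(u in e i) half_diff c u) * Psi c - Psi c).
Proof.
move=> t0 pos; elim: r => [|i r IH].
  by move=> k; rewrite big1 // => c _; rewrite big_nil expR0 mul1r subrr mulr0.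
case Pi : (P i); last first.
  by move=> k; under eq_bigr => c _ do rewrite big_cons Pi; apply: IH.
(* With [X] the new factor and [Y] the exponential of the tail, [X Y Psi - Psi] is split as
   [(X Y Psi - Y Psi) + (Y Psi - Psi)]. *)
have pos' := diff_positiveD IH pos.
have := diff_positiveD (@diff_positive_expB (e i) _ _ (t0 i Pi) pos') IH.
move=> + k => /(_ k); congr (_ <= _); apply: eq_bigr => c _.
by rewrite big_cons Pi expRD; ring.
Qed.

Lemma diff_positive_exp_sum (I : Type) (r : seq I) (P : pred I) (t : I -> R)
    (e : I -> {set V}) Psi :
  (forall i, P i -> 0 <= t i) -> diff_positive Psi ->
  diff_positive (fun c =>
    expR (\sum_(i <- r | P i) t i * \prod_(u in e i) half_diff c u) * Psi c).
Proof.
move=> t0 pos k; have := diff_positiveD (diff_positive_exp_sumB r e t0 pos) pos k.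
by congr (_ <= _); apply: eq_bigr => c _; rewrite subrK.
Qed.

(** * Half-difference monomials against the duplicated Gibbs weight *)

Section Weights.
Variables (E : {set {set V}}) (J : {set V} -> R).
Hypothesis J_ge0 : forall e, e \in E -> 0 <= J e.

Definition dup_energy A (c : dcfg) : R :=
  \sum_(e in E | e \subset A)
     2 * J e * (\prod_(u in e) half_sum c u + \prod_(u in e) half_diff c u).

(* [Q A] is a function of the [half_sum]s in [A] that ignores the sites where they vanish. *)
Definition interior_test (Q : {set V} -> dcfg -> R) :=
  (forall A, depends_on A (Q A)) /\
  (forall A S c, {in S, forall u, half_sum c u = 0} -> Q A c = Q (A :\: S) c).

Definition dup_weight (Q : {set V} -> dcfg -> R) A c := expR (dup_energy A c) * Q A c.

Lemma dup_energy_depends_on A : depends_on A (dup_energy A).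
Proof.
move=> c c' cc'; apply: eq_bigr => e /andP[_ /subsetP eA].
by congr (_ * (_ + _)); apply: eq_bigr => u ue; rewrite /half_sum /half_diff cc' ?eA.
Qed.

Lemma dup_weight_depends_on Q A : interior_test Q -> depends_on A (dup_weight Q A).
Proof.
by move=> [QA _] c c' cc'; rewrite /dup_weight (dup_energy_depends_on cc') (QA A c c').
Qed.

(** A nonzero [half_diff] forces [half_sum] to vanish, so an edge meeting [S] keeps only its
    [half_diff] term. *)
Lemma dup_energyD A S c : {in S, forall u, half_diff c u != 0} ->
  dup_energy A c = \sum_(e in E | (e \subset A) && ~~ (e \subset A :\: S))
    2 * J e * \prod_(u in e) half_diff c u + dup_energy (A :\: S) c.
Proof.
move=> dS; rewrite {1}/dup_energy (bigID (fun e => e \subset A :\: S)) /= addrC.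
congr (_ + _).
  apply: eq_big => [e|e /andP[/andP[_ eA] neS]]; first by rewrite -andbA.
  move: neS; rewrite subsetD eA /= => /pred0Pn[x /andP[/= xe xS]].
  by rewrite (bigD1 x) //= half_sum0 ?mul0r ?add0r // dS.
apply: eq_bigl => e; rewrite -andbA; congr (_ && _).
by rewrite subsetD andbA andbb.
Qed.

(** The monomial lives outside [A] and the weight inside, so the sum is a product of two nonnegative
    sums up to a positive factor. *)
Lemma sum_monomial_weight_ge0_off k A Q : interior_test Q ->
  {in A, forall u, k u = 0%N} -> 0 <= \sum_c dup_weight Q A c ->
  0 <= \sum_c diff_monomial k c * dup_weight Q A c.
Proof.
move=> Qi k0 posA.
rewrite -(pmulr_rge0 _ (card_cfg_gt0 (true, true))).
rewrite -(@sum_mul_independent _ (~: A)).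
- by rewrite mulr_ge0 ?sum_diff_monomial_ge0.
- move=> c c' cc'; apply: eq_bigr => u _.
  have [/k0 ->|uA] := boolP (u \in A); first by rewrite !expr0.
  by rewrite /half_diff cc' // inE.
- by rewrite setCK; apply: dup_weight_depends_on.
Qed.

Lemma sum_monomial_weight_ge0_step k A Q (S := [set u in A | k u != 0%N]) :
  interior_test Q -> diff_positive (dup_weight Q (A :\: S)) ->
  0 <= \sum_c diff_monomial k c * dup_weight Q A c.
Proof.
(* Where the monomial is nonzero, [half_sum] vanishes on [S], so only the
   [half_diff]-interactions of the edges meeting [S] remain, and these expand positively. *)
move=> [_ Qi] pos.
have J2 e : (e \in E) && ((e \subset A) && ~~ (e \subset A :\: S)) -> 0 <= 2 * J e.
  by case/andP => eE _; rewrite mulr_ge0 ?J_ge0.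
have := diff_positive_exp_sum (index_enum _) id J2 pos k.
congr (_ <= _); apply: eq_bigr => c _.
have [dS|] := boolP [forall u in S, half_diff c u != 0].
  have {}dS := forall_inP dS.
  rewrite /dup_weight (@dup_energyD A S c) // expRD -!mulrA; congr (_ * (_ * (_ * _))).
  by apply/esym/Qi => u uS; rewrite half_sum0 ?dS.
rewrite negb_forall_in => /exists_inP[u]; rewrite inE negbK => /andP[_ ku] /eqP du.
by rewrite /diff_monomial (bigD1 u) //= du expr0n (negbTE ku) !mul0r.
Qed.

(** Strong induction on [#|A|]: either the monomial misses [A], or its sites in [A] form a nonempty
    set whose removal leaves a smaller volume. *)
Lemma diff_positive_weight A Q : interior_test Q ->
  (forall B, B \subset A -> 0 <= \sum_c dup_weight Q B c) ->
  diff_positive (dup_weight Q A).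
Proof.
move=> Qi; have [n] := ubnP #|A|; elim: n A => // n IH A ltn pos k.
set S := [set u in A | k u != 0%N].
have [S0|[x xS]] := set_0Vmem S.
  apply: sum_monomial_weight_ge0_off => [//|u uA|]; last exact: pos.
  by apply/eqP/negPn/negP => ku; have := in_set0 u; rewrite -S0 inE uA ku.
apply: sum_monomial_weight_ge0_step => //; apply: IH => [|B BS]; last first.
  by apply: pos; apply: subset_trans BS (subsetDl _ _).
move: ltn; rewrite ltnS; apply: leq_trans; apply/proper_card/properP; split.
  exact: subsetDl.
by exists x; [move: xS; rewrite inE => /andP[] | rewrite inE xS].
Qed.

(** After one removal step the volume is disjoint from the support of [k], so signs are asked only
    of sub-volumes avoiding that support. *)
Lemma sum_monomial_weight_ge0 k A Q : interior_test Q ->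
  (forall B, B \subset A -> {in B, forall u, k u = 0%N} -> 0 <= \sum_c dup_weight Q B c) ->
  0 <= \sum_c diff_monomial k c * dup_weight Q A c.
Proof.
move=> Qi pos; apply: sum_monomial_weight_ge0_step => //.
apply: diff_positive_weight => // B /subsetP BS; apply: pos.
  by apply/subsetP => u /BS; rewrite inE => /andP[].
move=> u /BS; rewrite !inE => /andP[uS uA]; apply/eqP; move: uS.
by rewrite uA /= negbK.
Qed.

End Weights.
End Duplicated.

Arguments half_sum {R V}.
Arguments half_diff {R V}.
Arguments diff_monomial {R V}.

(** * Spin sums in an imaginary field and their duplicated form *)

Section ImaginaryField.
Variables (R : realType) (V : finType) (E : {set {set V}}) (lambda : V -> R).
Hypothesis E_simple : simple_graph E.
Implicit Types (A B S : {set V}) (J : {set V} -> R) (u v w : V) (r : R).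
Local Notation cfg := {ffun V -> bool}.
Local Notation sp := (spin R).

Definition flip (s : cfg) : cfg := [ffun u => ~~ s u].

Lemma spinN b : sp (~~ b) = - sp b.
Proof. by case: b; rewrite /spin ?opprK. Qed.

Lemma flipK : involutive flip.
Proof. by move=> s; apply/ffunP => u; rewrite !ffunE negbK. Qed.

Definition energy J A (s : cfg) : R :=
  \sum_(e in E | e \subset A) J e * \prod_(u in e) sp (s u).

Definition magnetization A (s : cfg) : R := \sum_(u in A) lambda u * sp (s u).

(* The spins outside [A] are summed over too, which only multiplies the sum by a power of 2. *)
Definition wsum J A (phi : cfg -> R) : R := \sum_s expR (energy J A s) * phi s.

Lemma edgeP e : e \in E -> exists x y, x != y /\ e = [set x; y].
Proof. by move=> /E_simple/eqP/cards2P. Qed.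

Lemma prod_edge x y (g : V -> R) : x != y -> \prod_(u in [set x; y]) g u = g x * g y.
Proof. by move=> xy; rewrite big_setU1 ?big_set1 // inE. Qed.

Lemma energy_flip J A s : energy J A (flip s) = energy J A s.
Proof.
apply: eq_bigr => e /andP[/edgeP[x [y [xy ->]]] _].
by rewrite !prod_edge // !ffunE !spinN mulrNN.
Qed.

Lemma magnetization_flip A s : magnetization A (flip s) = - magnetization A s.
Proof. by rewrite -sumrN; apply: eq_bigr => u _; rewrite ffunE spinN mulrN. Qed.

Lemma wsum_flip J A phi : wsum J A phi = wsum J A (phi \o flip).
Proof.
rewrite /wsum (reindex_inj (inv_inj flipK)) /=.
by apply: eq_bigr => s _; rewrite energy_flip.
Qed.

Lemma wsum_odd J A phi : (forall s, phi (flip s) = - phi s) -> wsum J A phi = 0.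
Proof.
move=> odd; have : wsum J A phi = - wsum J A phi.
  by rewrite {1}wsum_flip -sumrN; apply: eq_bigr => s _; rewrite /= odd mulrN.
lra.
Qed.

Definition fst_cfg (c : {ffun V -> bool * bool}) : cfg := [ffun u => (c u).1].
Definition snd_cfg (c : {ffun V -> bool * bool}) : cfg := [ffun u => (c u).2].

Lemma dup_energyE J A c :
  dup_energy E J A c = energy J A (fst_cfg c) + energy J A (snd_cfg c).
Proof.
rewrite -big_split; apply: eq_bigr => e /andP[/edgeP[x [y [xy ->]]] _] /=.
by rewrite !prod_edge // !ffunE /half_sum /half_diff; field.
Qed.

Lemma wsumM J A phi psi : wsum J A phi * wsum J A psi =
  \sum_c expR (dup_energy E J A c) * (phi (fst_cfg c) * psi (snd_cfg c)).
Proof.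
pose pr (c : {ffun V -> bool * bool}) := (fst_cfg c, snd_cfg c).
rewrite big_distrlr pair_bigA /= (reindex pr) /=.
  by apply: eq_bigr => c _; rewrite dup_energyE expRD; ring.
exists (fun p : cfg * cfg => [ffun u => (p.1 u, p.2 u)]) => [c|[s t]] _.
  by apply/ffunP => u; rewrite !ffunE; case: (c u).
by congr (_, _); apply/ffunP => u; rewrite !ffunE.
Qed.

(** Up to normalization, the partition function in the field [i r lambda]; [Ssum], [Gsum] and [Tsum]
    arise from it by successive differentiation in [r]. *)
Definition Fsum J A r := wsum J A (fun s => cos (r * magnetization A s)).
Definition Ssum J A u r := wsum J A (fun s => sp (s u) * sin (r * magnetization A s)).
Definition Gsum J A u v r :=
  wsum J A (fun s => sp (s u) * sp (s v) * cos (r * magnetization A s)).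
Definition Tsum J A u v w r :=
  wsum J A (fun s => sp (s u) * sp (s v) * sp (s w) * sin (r * magnetization A s)).

Definition dup_angle A r (c : {ffun V -> bool * bool}) : R :=
  r * (\sum_(u in A) 2 * lambda u * half_sum c u).

Definition cos_test r A c : R := cos (dup_angle A r c).
(** The indicator kills the test on volumes without [u], just as [half_sum c u] does when [u] lies
    in the removed set; this makes the test interior. *)
Definition sin_test u r A c : R := (u \in A)%:R * half_sum c u * sin (dup_angle A r c).

Lemma dup_angleE A r c : dup_angle A r c =
  r * magnetization A (fst_cfg c) + r * magnetization A (snd_cfg c).
Proof.
rewrite /dup_angle -mulrDr -big_split; congr (_ * _); apply: eq_bigr => u _ /=.
by rewrite !ffunE /half_sum; field.
Qed.

Lemma dup_angle_depends_on A r : depends_on A (dup_angle A r).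
Proof.
by move=> c c' cc'; congr (_ * _); apply: eq_bigr => u uA; rewrite /half_sum cc'.
Qed.

Lemma dup_angleD A S r c : {in S, forall u, half_sum c u = 0 :> R} ->
  dup_angle A r c = dup_angle (A :\: S) r c.
Proof.
move=> S0; congr (_ * _); rewrite (big_setID S) /= big1 ?add0r // => u.
by rewrite inE => /andP[_ /S0 ->]; rewrite mulr0.
Qed.

Lemma cos_test_interior r : interior_test (cos_test r).
Proof.
split=> [A c c' cc'|A S c S0]; first by rewrite /cos_test (dup_angle_depends_on _ cc').
by rewrite /cos_test (dup_angleD _ _ S0).
Qed.

Lemma sin_test_interior u r : interior_test (sin_test u r).
Proof.
split=> [A c c' cc'|A S c S0]; rewrite /sin_test.
  rewrite (dup_angle_depends_on _ cc').
  by have [uA|_] := boolP (u \in A); [rewrite /half_sum cc' | rewrite !mul0r].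
rewrite (dup_angleD _ _ S0) inE; have [/S0 ->|_//] := boolP (u \in S).
by rewrite !mulr0 !mul0r.
Qed.

Local Ltac parity := apply: wsum_odd => s; 
  rewrite ?magnetization_flip ?mulrN ?sinN ?cosN ?ffunE ?spinN; ring.

(** In the addition formula the product of sines drops out by spin-flip parity. Being a square, the
    sum is nonnegative with no knowledge of the zeros. *)
Lemma sum_cos_test J A r : \sum_c dup_weight E J (cos_test r) A c = Fsum J A r ^+ 2.
Proof.
have S0 : wsum J A (fun s => sin (r * magnetization A s)) = 0 by parity.
set s_ := (fun s => _) in S0.
transitivity (Fsum J A r * Fsum J A r - wsum J A s_ * wsum J A s_).
  rewrite !wsumM -sumrB; apply: eq_bigr => c _.
  by rewrite /dup_weight /cos_test dup_angleE cosD mulrBr.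
by rewrite S0; ring.
Qed.

Lemma sum_sin_test J A u r : u \in A ->
  \sum_c dup_weight E J (sin_test u r) A c = Ssum J A u r * Fsum J A r.
Proof.
move=> uA.
have s0 : wsum J A (fun s => sin (r * magnetization A s)) = 0 by parity.
have c0 : wsum J A (fun s => sp (s u) * cos (r * magnetization A s)) = 0 by parity.
set s_ := (fun s => sin _) in s0; set c_ := (fun s => sp _ * _) in c0.
transitivity ((Ssum J A u r * Fsum J A r + wsum J A c_ * wsum J A s_ +
  wsum J A s_ * wsum J A c_ + Fsum J A r * Ssum J A u r) / 2); last first.
  by rewrite s0 c0; field.
rewrite !wsumM -!big_split mulr_suml; apply: eq_bigr => c _ /=.
rewrite /dup_weight /sin_test uA mulr1n dup_angleE sinD /half_sum /s_ /c_ !ffunE.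
by field.
Qed.

Lemma diff_monomial2 u v c :
  diff_monomial (fun x => (x == u) + (x == v))%N c = half_diff c u * half_diff c v :> R.
Proof. by rewrite diff_monomialD !diff_monomial_pred1. Qed.

(** * Correlation inequalities in an imaginary field *)

Section Positivity.
Variable J : {set V} -> R.
Hypothesis J_ge0 : forall e, e \in E -> 0 <= J e.

(** The monomial [d_u d_w] is tested against the cosine. Summed over [w] with weights [lambda w],
    the expression is the numerator of the derivative of [Ssum / Fsum]. *)
Lemma GF_SS_ge0 A u w r : 0 <= Gsum J A u w r * Fsum J A r + Ssum J A u r * Ssum J A w r.
Proof.
have s0 : wsum J A (fun s => sp (s u) * sp (s w) * sin (r * magnetization A s)) = 0 by parity.
have s1 : wsum J A (fun s => sin (r * magnetization A s)) = 0 by parity.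
have cu : wsum J A (fun s => sp (s u) * cos (r * magnetization A s)) = 0 by parity.
have cw : wsum J A (fun s => sp (s w) * cos (r * magnetization A s)) = 0 by parity.
set s0_ := (fun s => _ * sin _) in s0; set s1_ := (fun s => sin _) in s1.
set cu_ := (fun s => sp _ * _) in cu; set cw_ := (fun s => sp _ * _) in cw.
have := @sum_monomial_weight_ge0 _ _ _ _ J_ge0
  (fun x => (x == u) + (x == w))%N A _ (cos_test_interior r) _.
have -> : \sum_c diff_monomial (fun x => (x == u) + (x == w))%N c *
    dup_weight E J (cos_test r) A c =
  (Gsum J A u w r * Fsum J A r + Fsum J A r * Gsum J A u w r
   + Ssum J A u r * Ssum J A w r + Ssum J A w r * Ssum J A u r
   - wsum J A s0_ * wsum J A s1_ - wsum J A s1_ * wsum J A s0_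
   - wsum J A cu_ * wsum J A cw_ - wsum J A cw_ * wsum J A cu_) / 4.
  rewrite !wsumM -!big_split -!sumrB mulr_suml; apply: eq_bigr => c _ /=.
  rewrite diff_monomial2 /dup_weight /cos_test dup_angleE cosD /half_diff.
  by rewrite /s0_ /s1_ /cu_ /cw_ !ffunE; field.
rewrite s0 s1 cu cw => h.
have /h : forall B, B \subset A -> {in B, forall x, ((x == u) + (x == w) = 0)%N} ->
    0 <= \sum_c dup_weight E J (cos_test r) B c.
  by move=> B _ _; rewrite sum_cos_test sqr_ge0.
by move=> {}h; lra.
Qed.

(** Based on [a_u d_v + a_v d_u = (s_u s_v - s'_u s'_v) / 2], multiplied by [d_w] and the sine of
    the angle. Weighted by [lambda w] and summed, the expression is minus the numerator of the
    derivative of [Gsum / Fsum]. *)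
Lemma TF_GS_ge0 A u v w r : u \in A -> v \in A ->
  (forall B, B \subset A -> v \notin B -> u \in B -> 0 <= Ssum J B u r * Fsum J B r) ->
  (forall B, B \subset A -> u \notin B -> v \in B -> 0 <= Ssum J B v r * Fsum J B r) ->
  0 <= Tsum J A u v w r * Fsum J A r - Gsum J A u v r * Ssum J A w r.
Proof.
have side x y : (forall B, B \subset A -> y \notin B -> x \in B ->
      0 <= Ssum J B x r * Fsum J B r) ->
    0 <= \sum_c diff_monomial (fun z => (z == y) + (z == w))%N c *
       dup_weight E J (sin_test x r) A c.
  (* Volumes containing [y] are excluded by the monomial, and on volumes without [x] the test is
     zero. *)
  move=> pos; apply: (sum_monomial_weight_ge0 J_ge0 (sin_test_interior x r)) => B BA k0.
  have [xB|xB] := boolP (x \in B).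
    rewrite sum_sin_test // pos //; apply/negP => /k0; by rewrite eqxx.
  rewrite big1 // => c _; by rewrite /dup_weight /sin_test (negbTE xB) !mul0r mulr0.
move=> uA vA /side hu /side hv.
have c0 : wsum J A (fun s => sp (s u) * sp (s v) * sp (s w) * cos (r * magnetization A s)) = 0 by parity.
have cw : wsum J A (fun s => sp (s w) * cos (r * magnetization A s)) = 0 by parity.
have s0 : wsum J A (fun s => sin (r * magnetization A s)) = 0 by parity.
have s2 : wsum J A (fun s => sp (s u) * sp (s v) * sin (r * magnetization A s)) = 0 by parity.
set c0_ := (fun s => _) in c0; set cw_ := (fun s => _) in cw.
set s0_ := (fun s => _) in s0; set s2_ := (fun s => _) in s2.
have := addr_ge0 hu hv; rewrite -big_split /=.
rewrite (_ : \sum_c _ =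
  (Tsum J A u v w r * Fsum J A r + Fsum J A r * Tsum J A u v w r
   + wsum J A c0_ * wsum J A s0_ + wsum J A s0_ * wsum J A c0_
   - Gsum J A u v r * Ssum J A w r - Ssum J A w r * Gsum J A u v r
   - wsum J A s2_ * wsum J A cw_ - wsum J A cw_ * wsum J A s2_) / 4); last first.
  rewrite !wsumM -!big_split -!sumrB mulr_suml; apply: eq_bigr => c _ /=.
  rewrite !diff_monomial2 /dup_weight /sin_test uA vA mulr1n dup_angleE sinD /half_diff /half_sum.
  by rewrite /s0_ /s2_ /c0_ /cw_ !ffunE; field.
by rewrite s0 s2 c0 cw => h; lra.
Qed.

End Positivity.
End ImaginaryField.

(** * Ratios and first zeros of real functions *)

Section RealFunctions.
Variable R : realType.
Implicit Types (f g : R -> R) (a b s t : R).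

Lemma is_derive_big_sum (I : Type) (l : seq I) (h : I -> R -> R) (dh : I -> R) (x : R) :
  (forall i, is_derive x 1 (h i) (dh i)) ->
  is_derive x 1 (fun y => \sum_(i <- l) h i y) (\sum_(i <- l) dh i).
Proof.
move=> hd; elim: l => [|i l IH].
  rewrite big_nil (_ : (fun y => _) = cst 0); first exact: is_derive_cst.
  by apply/funext => y; rewrite big_nil.
rewrite big_cons (_ : (fun y => _) = (h i + (fun y => \sum_(j <- l) h j y))).
  exact: is_deriveD.
by apply/funext => y; rewrite big_cons.
Qed.

Lemma is_derive_mulr (m x : R) : is_derive x 1 (fun y : R => y * m) m.
Proof.
rewrite (_ : (fun y => _) = m \*: (id : R -> R)).
  by have := is_deriveZ m (is_derive_id x (1 : R)); rewrite /GRing.scale /= mulr1.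
by apply/funext => y; rewrite /= /GRing.scale /= mulrC.
Qed.

Lemma is_derive_cosM (c m x : R) :
  is_derive x 1 (fun y => c * cos (y * m)) (- (c * m * sin (x * m))).
Proof.
have := is_deriveZ c (@is_derive1_comp _ _ _ x _ _ (is_derive_cos (x * m)) (is_derive_mulr m x)).
by rewrite /GRing.scale /= => h; apply: is_derive_eq h _; ring.
Qed.

Lemma is_derive_sinM (c m x : R) :
  is_derive x 1 (fun y => c * sin (y * m)) (c * m * cos (x * m)).
Proof.
have := is_deriveZ c (@is_derive1_comp _ _ _ x _ _ (is_derive_sin (x * m)) (is_derive_mulr m x)).
by rewrite /GRing.scale /= => h; apply: is_derive_eq h _; ring.
Qed.

Lemma is_derive_continuous f df : (forall x : R, is_derive x 1 f (df x)) -> continuous f.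
Proof.
move=> fd x; apply: differentiable_continuous.
by apply/derivable1_diffP; apply: (@ex_derive _ _ _ _ _ _ _ (fd x)).
Qed.

Lemma ratio_nondecreasing f g df dg a b : a <= b ->
  (forall x : R, is_derive x 1 f (df x)) -> (forall x : R, is_derive x 1 g (dg x)) ->
  (forall x, a <= x <= b -> 0 < f x) ->
  (forall x, a <= x <= b -> 0 <= dg x * f x - g x * df x) ->
  g a * f b <= g b * f a.
Proof.
move=> ab fd gd fpos num.
pose h x := g x * (f x)^-1.
pose dh x := (dg x * f x - g x * df x) / f x ^+ 2.
have hd x : a <= x <= b -> is_derive x 1 h (dh x).
  move=> /fpos fx; have fx0 : f x != 0 by rewrite gt_eqF.
  have := is_deriveM (gd x) (is_deriveV fx0 (fd x)).
  by rewrite /GRing.scale /= => H; apply: is_derive_eq H _; rewrite /dh; field.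
have [x xab|x|c cab E] := @MVT_segment _ h dh a b ab.
- by apply: hd; move: xab; rewrite in_itv /= => /andP[/ltW -> /ltW ->].
- apply: derivable_within_continuous => y; rewrite in_itv /= => /hd yd.
  exact: (@ex_derive _ _ _ _ _ _ _ yd).
have hab : h a <= h b.
  rewrite -subr_ge0 E mulr_ge0 ?subr_ge0 // /dh divr_ge0 ?sqr_ge0 //.
  by apply: num; move: cab; rewrite in_itv.
have fa : 0 < f a by apply: fpos; rewrite lexx.
have fb : 0 < f b by apply: fpos; rewrite lexx andbT.
by move: hab; rewrite /h ler_pdivlMr // mulrAC ler_pdivrMr.
Qed.

Lemma zero_between f a b : continuous f -> a <= b -> 0 <= f a -> f b <= 0 ->
  exists2 c, a <= c <= b & f c = 0.
Proof.
move=> fc ab fa fb.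
have [||c] := @IVT _ f a b 0 ab; first exact: continuous_subspaceT.
  by rewrite ge_min le_max fa fb orbT.
by rewrite in_itv /=; exists c.
Qed.

(** The point is the infimum of the nonnegative zeros, attained by continuity; a nonpositive value
    before it would create an earlier zero. *)
Lemma first_zero f t : continuous f -> 0 <= t -> 0 < f 0 -> f t <= 0 ->
  exists s, [/\ 0 <= s <= t, f s = 0 & forall x, 0 <= x < s -> 0 < f x].
Proof.
move=> fc t0 f0 ft.
pose Z : set R := fun x => 0 <= x /\ f x = 0.
have Zlb : has_lbound Z by exists 0 => x [].
have [z /andP[z0 zt] fz] := zero_between fc t0 (ltW f0) ft.
have Zz : Z z by [].
have Zn : (Z !=set0)%classic by exists z.
have sz : inf Z <= z by apply: ge_inf.
have s0 : 0 <= inf Z by apply: lb_le_inf => // x [].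
exists (inf Z); split; first by rewrite s0 (le_trans sz).
  apply/eqP/negPn/negP => fs.
  have e0 : 0 < `|f (inf Z)| by rewrite normr_gt0.
  have nb : \forall x \near inf Z, `|f (inf Z) - f x| < `|f (inf Z)|.
    exact: (@cvgr_dist_lt _ _ _ _ _ _ _ (fc (inf Z)) _ e0).
  have [e /= e_gt0 He] := (nbhs_ballP _ _).1 nb.
  have [x Zx xe] := inf_adherent e_gt0 (conj Zn Zlb).
  have sx : inf Z <= x by apply: ge_inf.
  have : ball (inf Z) e x.
    by rewrite /ball /= distrC ger0_norm ?subr_ge0 // ltrBlDl.
  by move=> /He /=; case: Zx => _ ->; rewrite subr0 ltxx.
move=> x /andP[x0 xs]; rewrite ltNge; apply/negP => fx.
have [y /andP[y0 yx] fy] := zero_between fc x0 (ltW f0) fx.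
have : inf Z <= y by apply: ge_inf.
by rewrite leNgt (le_lt_trans yx).
Qed.

Lemma continuous_big_prod (I : Type) (l : seq I) (P : pred I) (f : I -> R -> R) :
  (forall j, continuous (f j)) -> continuous (fun x => \prod_(j <- l | P j) f j x).
Proof.
move=> fc; elim: l => [|j l IH] x.
  rewrite (_ : (fun _ => _) = cst 1); first exact: cst_continuous.
  by apply/funext => y; rewrite big_nil.
rewrite (_ : (fun _ => _) = fun y => (if P j then f j y else 1) * \prod_(i <- l | P i) f i y).
  by apply: continuousM; [case: (P j); [apply: fc | apply: cst_continuous] | apply: IH].
by apply/funext => y; rewrite big_cons; case: (P j); rewrite ?mul1r.
Qed.

(** The first zero of the product of the family is a zero of one factor and precedes any zero of the
    others. *)
Lemma first_zero_family (I : finType) (P : pred I) (f : I -> R -> R) i t :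
  (forall j, continuous (f j)) -> (forall j, 0 < f j 0) -> 0 <= t -> P i -> f i t <= 0 ->
  exists s j, [/\ 0 <= s <= t, P j, f j s = 0
    & forall k x, P k -> 0 <= x < s -> 0 < f k x].
Proof.
move=> fc f0 t0 Pi fit.
pose F x := \prod_(j | P j) f j x.
have Fc : continuous F by apply: continuous_big_prod.
have F0 : 0 < F 0 by apply: prodr_gt0.
have [r [/andP[r0 rt] fir _]] := first_zero (fc i) t0 (f0 i) fit.
have Fr : F r <= 0 by rewrite /F (bigD1 i) //= fir mul0r.
have [s [/andP[s0 sr] Fs Fpos]] := first_zero Fc r0 F0 Fr.
move/eqP: Fs; rewrite prodf_seq_eq0 => /hasP[j _ /andP[Pj /eqP fjs]].
exists s, j; split=> //; first by rewrite s0 (le_trans sr).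
move=> k x Pk /andP[x0 xs]; rewrite ltNge; apply/negP => fkx.
have [y [/andP[y0 yx] fky _]] := first_zero (fc k) x0 (f0 k) fkx.
have := Fpos y; rewrite y0 (le_lt_trans yx) // => /(_ isT).
by rewrite /F (bigD1 k) //= fky mul0r ltxx.
Qed.

Lemma ge0_left_limit f s : continuous f -> 0 < s ->
  (forall x, 0 <= x < s -> 0 <= f x) -> 0 <= f s.
Proof.
move=> fc s0 fpos; have f0 : 0 <= f 0 by apply: fpos; rewrite lexx.
rewrite leNgt; apply/negP => fs.
(* The level [f s / 2] is negative and differs from [f s], so it is attained strictly before [s]. *)
have [||c] := @IVT _ f 0 s (f s / 2) (ltW s0); first exact: continuous_subspaceT.
  rewrite ge_min le_max; apply/andP; split; apply/orP; [right|left]; lra.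
rewrite in_itv /= => /andP[c0 cs] fcE.
have {}cs : c < s by rewrite lt_neqAle cs andbT; apply/eqP => csE; move: fcE; rewrite csE; lra.
by have := fpos c; rewrite c0 cs fcE => /(_ isT); lra.
Qed.

End RealFunctions.

(** * Derivatives in the field and the two ratio bounds *)

Section Monotonicity.
Variables (R : realType) (V : finType) (E : {set {set V}}) (lambda : V -> R).
Hypothesis E_simple : simple_graph E.
Hypothesis lambda_ge0 : forall u, 0 <= lambda u.
Implicit Types (A B C : {set V}) (J : {set V} -> R) (u v w : V) (r : R).
Local Notation cfg := {ffun V -> bool}.
Local Notation sp := (spin R).
Local Notation F := (Fsum E lambda).
Local Notation S := (Ssum E lambda).
Local Notation G := (Gsum E lambda).
Local Notation T := (Tsum E lambda).
Local Notation mag := (magnetization lambda).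

Lemma wsum_mag J A (phi psi : cfg -> R) :
  wsum E J A (fun s => phi s * mag A s * psi s) =
  \sum_(w in A) lambda w * wsum E J A (fun s => phi s * sp (s w) * psi s).
Proof.
under [RHS]eq_bigr => w _ do rewrite mulr_sumr.
rewrite exchange_big; apply: eq_bigr => s _ /=.
rewrite /magnetization mulr_sumr mulr_suml mulr_sumr.
by apply: eq_bigr => w _; ring.
Qed.

Lemma is_derive_wsum_cos J A (phi : cfg -> R) r :
  is_derive r 1 (fun x => wsum E J A (fun s => phi s * cos (x * mag A s)))
    (- \sum_(w in A) lambda w * wsum E J A (fun s => phi s * sp (s w) * sin (r * mag A s))).
Proof.
rewrite -wsum_mag /wsum -sumrN.
rewrite (_ : (fun x => _) = fun x =>
  \sum_s (expR (energy E J A s) * phi s) * cos (x * mag A s)); last first.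
  by apply/funext => x; apply: eq_bigr => s _; rewrite mulrA.
apply: is_derive_eq (is_derive_big_sum _ (fun s => is_derive_cosM _ (mag A s) r)) _.
by apply: eq_bigr => s _; ring.
Qed.

Lemma is_derive_wsum_sin J A (phi : cfg -> R) r :
  is_derive r 1 (fun x => wsum E J A (fun s => phi s * sin (x * mag A s)))
    (\sum_(w in A) lambda w * wsum E J A (fun s => phi s * sp (s w) * cos (r * mag A s))).
Proof.
rewrite -wsum_mag /wsum.
rewrite (_ : (fun x => _) = fun x =>
  \sum_s (expR (energy E J A s) * phi s) * sin (x * mag A s)); last first.
  by apply/funext => x; apply: eq_bigr => s _; rewrite mulrA.
apply: is_derive_eq (is_derive_big_sum _ (fun s => is_derive_sinM _ (mag A s) r)) _.
by apply: eq_bigr => s _; ring.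
Qed.

Lemma is_derive_Fsum J A r : is_derive r 1 (F J A) (- \sum_(w in A) lambda w * S J A w r).
Proof.
have := is_derive_wsum_cos J A (fun=> 1) r.
rewrite (_ : (fun x => _) = F J A); last first.
  by apply/funext => x; apply: eq_bigr => s _; rewrite mul1r.
move=> h; apply: is_derive_eq h _; congr (- _); apply: eq_bigr => w _.
by congr (_ * _); apply: eq_bigr => s _; rewrite mul1r.
Qed.

Lemma continuous_Fsum J A : continuous (F J A).
Proof. exact: is_derive_continuous (is_derive_Fsum J A). Qed.

Lemma continuous_Gsum J A u v : continuous (G J A u v).
Proof. exact: is_derive_continuous (is_derive_wsum_cos J A _). Qed.

Lemma Fsum0_gt0 J A : 0 < F J A 0.
Proof.
rewrite /Fsum /wsum; under eq_bigr => s _ do rewrite mul0r cos0 mulr1.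
rewrite (bigD1 [ffun=> true]) //= ltr_wpDr ?expR_gt0 //.
by apply: sumr_ge0 => s _; apply: expR_ge0.
Qed.

Lemma Fsum_even J A r : F J A (- r) = F J A r.
Proof. by apply: eq_bigr => s _; rewrite mulNr cosN. Qed.

Lemma Ssum0 J A u : S J A u 0 = 0.
Proof. by rewrite /Ssum /wsum big1 // => s _; rewrite mul0r sin0 !mulr0. Qed.

Lemma Gsum0_le J A u v : G J A u v 0 <= F J A 0.
Proof.
apply: ler_sum => s _; rewrite ler_wpM2l ?expR_ge0 // mul0r cos0 mulr1.
by case: (s u) (s v) => -[]; rewrite /spin; lra.
Qed.

(** By [GF_SS_ge0] the ratio [Ssum / Fsum] is nondecreasing, and it starts at zero. *)
Lemma Ssum_ge0 J A u r : (forall e, e \in E -> 0 <= J e) -> 0 <= r ->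
  (forall x, 0 <= x <= r -> 0 < F J A x) -> 0 <= S J A u r.
Proof.
move=> J0 r0 Fpos.
have := ratio_nondecreasing r0 (is_derive_Fsum J A)
  (is_derive_wsum_sin J A (fun s => sp (s u))) Fpos.
rewrite -/(S J A u 0) -/(S J A u r) Ssum0 mul0r pmulr_lge0 ?Fsum0_gt0 //; apply.
move=> x _; rewrite mulr_suml mulrN opprK mulr_sumr -big_split.
apply: sumr_ge0 => w _ /=.
have -> : lambda w * wsum E J A (fun s => sp (s u) * sp (s w) * cos (x * mag A s)) * F J A x +
    wsum E J A (fun s => sp (s u) * sin (x * mag A s)) * (lambda w * S J A w x) =
  lambda w * (G J A u w x * F J A x + S J A u x * S J A w x) by rewrite /Gsum /Ssum; ring.
by rewrite mulr_ge0 // GF_SS_ge0.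
Qed.

(** By [TF_GS_ge0] the ratio [Gsum / Fsum] is nonincreasing, and it starts at most at 1. The signs
    required there come from [Ssum_ge0] in every sub-volume. *)
Lemma Gsum_le_Fsum J A u v r : (forall e, e \in E -> 0 <= J e) -> u \in A -> v \in A ->
  0 <= r -> (forall B x, B \subset A -> 0 <= x <= r -> 0 < F J B x) ->
  G J A u v r <= F J A r.
Proof.
move=> J0 uA vA r0 Fpos.
have SF B x w : B \subset A -> 0 <= x <= r -> 0 <= S J B w x * F J B x.
  move=> BA xr; rewrite mulr_ge0 ?(ltW (Fpos _ _ BA xr)) //.
  case/andP: xr => x0 xr; apply: Ssum_ge0 => // y /andP[y0 yx].
  by apply: Fpos; rewrite // y0 (le_trans yx).
have FA x := Fpos A x (subxx A).
have Gd x := is_deriveN (is_derive_wsum_cos J A (fun s => sp (s u) * sp (s v)) x).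
have := ratio_nondecreasing r0 (is_derive_Fsum J A) Gd FA.
rewrite /= -/(G J A u v 0) -/(G J A u v r) => H.
have {H} : G J A u v r * F J A 0 <= G J A u v 0 * F J A r.
  rewrite -lerN2 -!mulNr; apply: H => x xr.
  rewrite opprK mulr_suml mulNr mulrN opprK mulr_sumr -sumrN -big_split.
  apply: sumr_ge0 => w _ /=.
  have -> : lambda w * wsum E J A (fun s => sp (s u) * sp (s v) * sp (s w) *
        sin (x * mag A s)) * F J A x -
      wsum E J A (fun s => sp (s u) * sp (s v) * cos (x * mag A s)) * (lambda w * S J A w x) =
    lambda w * (T J A u v w x * F J A x - G J A u v x * S J A w x).
    by rewrite /Gsum /Tsum; ring.
  rewrite mulr_ge0 // TF_GS_ge0 // => B BA _ _; exact: SF.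
move=> h; rewrite -(ler_pM2r (Fsum0_gt0 J A)); apply: le_trans h _.
rewrite [leRHS]mulrC ler_wpM2r ?Gsum0_le // ltW // FA // r0 lexx //.
Qed.

(** * Zero-freeness under smaller couplings and smaller volumes *)

Lemma wsum_ext J J' A phi : (forall e, e \in E -> e \subset A -> J e = J' e) ->
  wsum E J A phi = wsum E J' A phi.
Proof.
move=> JJ; apply: eq_bigr => s _; congr (expR _ * _).
by apply: eq_bigr => e /andP[eE eA]; rewrite JJ.
Qed.

(* exp(d s_u s_v) = cosh(d) + sinh(d) s_u s_v *)
Lemma Fsum_edge J J' A u v r (e0 := [set u; v]) : u != v -> e0 \in E -> e0 \subset A ->
  (forall e, e != e0 -> J' e = J e) ->
  F J A r = (expR (J e0 - J' e0) + expR (- (J e0 - J' e0))) / 2 * F J' A r +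
    (expR (J e0 - J' e0) - expR (- (J e0 - J' e0))) / 2 * G J' A u v r.
Proof.
move=> uv eE eA JJ; set d := J e0 - J' e0.
rewrite /Fsum /Gsum /wsum !mulr_sumr -big_split; apply: eq_bigr => s _ /=.
have -> : energy E J A s = energy E J' A s + d * (sp (s u) * sp (s v)).
  rewrite /energy (bigD1 e0) ?eE //= [in RHS](bigD1 e0) ?eE //=.
  rewrite (eq_bigr (fun e => J' e * \prod_(x in e) sp (s x))).
    by rewrite prod_edge // /d; ring.
  by move=> e /andP[_ /JJ ->].
rewrite expRD.
have [->|->] : sp (s u) * sp (s v) = 1 \/ sp (s u) * sp (s v) = - 1.
- by case: (s u) (s v) => -[]; rewrite /spin ?mulrNN ?mulr1 ?mul1r; [left|right|right|left].
- by rewrite mulr1; field.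
- by rewrite mulrN1; field.
Qed.

Definition positive_upto J A (s : R) := forall x, 0 <= x <= s -> 0 < F J A x.

(** At a first zero [t] for [J'] the correlation sum [Gsum] is nonpositive, so raising the coupling
    back to [J e0] leaves [Fsum] nonpositive at [t], against the hypothesis on [J]. *)
Lemma positive_upto_edge J J' A e0 (s : R) :
  (forall e, e \in E -> 0 <= J' e) -> (forall e, e != e0 -> J' e = J e) -> J' e0 <= J e0 ->
  (forall B x, B \proper A -> 0 <= x < s -> 0 < F J' B x) ->
  positive_upto J A s -> positive_upto J' A s.
Proof.
move=> J'0 JJ le0 Bpos pos.
have [/andP[e0E e0A]|ne0] := boolP ((e0 \in E) && (e0 \subset A)); last first.
  move=> x /pos; rewrite /Fsum (@wsum_ext J J') // => e eE eA.
  by apply/esym/JJ; apply: contraNneq ne0 => <-; rewrite eE.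
have [u [v [uv e0uv]]] := edgeP E_simple e0E; subst e0.
have [uA vA] : u \in A /\ v \in A by move: e0A; rewrite subUset !sub1set => /andP.
move=> x /andP[x0 xs]; rewrite ltNge; apply/negP => Fx.
have [t [/andP[t0 tx] Ft Fpos]] := first_zero (@continuous_Fsum J' A) x0 (Fsum0_gt0 J' A) Fx.
have ts : t <= s by apply: le_trans xs.
have tpos : 0 < t.
  by rewrite lt_neqAle t0 andbT; apply/eqP => t0E; move: Ft; rewrite -t0E => F0;
     have := Fsum0_gt0 J' A; rewrite F0 ltxx.
have Gneg : G J' A u v t <= 0.
  have : 0 <= F J' A t - G J' A u v t; last by rewrite Ft; lra.
  (* [Gsum_le_Fsum] needs positivity at the endpoint too, which fails at [t]; it is used before [t]
     and passed to the limit. *)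
  apply: (@ge0_left_limit _ (fun y => F J' A y - G J' A u v y)) => //.
  - by move=> y; apply: continuousB; [apply: continuous_Fsum | apply: continuous_Gsum].
  - move=> y /andP[y0 yt]; rewrite subr_ge0; apply: Gsum_le_Fsum => // B z BA /andP[z0 zy].
    have zt := le_lt_trans zy yt.
    move: BA; rewrite subEproper => /orP[/eqP ->|BA]; first by rewrite Fpos // z0.
    by rewrite Bpos // z0 (lt_le_trans zt).
have := pos t; rewrite t0 ts => /(_ isT).
rewrite (Fsum_edge _ uv e0E e0A JJ) Ft mulr0 add0r ltNge => /negP; apply.
by rewrite mulr_ge0_le0 // divr_ge0 // subr_ge0 ler_expR; lra.
Qed.

Lemma positive_upto_couplings J J' A (s : R) :
  (forall e, e \in E -> 0 <= J' e <= J e) ->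
  (forall B J'' x, B \proper A -> (forall e, e \in E -> 0 <= J'' e <= J e) ->
     0 <= x < s -> 0 < F J'' B x) ->
  positive_upto J A s -> positive_upto J' A s.
Proof.
move=> JJ Bpos pos.
(* Interpolation that lowers the couplings one edge at a time. *)
pose Jl (l : seq {set V}) e := if e \in l then J' e else J e.
have Jl_le l e : e \in E -> 0 <= Jl l e <= J e.
  move=> /JJ /andP[h h']; rewrite /Jl; case: ifP => _; first by rewrite h.
  by rewrite lexx (le_trans h).
have step l : all (mem E) l -> positive_upto (Jl l) A s.
  elim: l => [//|e0 l IH] /= /andP[e0E /IH {}IH].
  apply: (@positive_upto_edge (Jl l) _ A e0) => //.
  - by move=> e /(Jl_le (e0 :: l)) /andP[].
  - by move=> e /negbTE ee0; rewrite /Jl inE ee0.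
  - rewrite {1}/Jl inE eqxx /= /Jl; case: ifP => // _.
    by have /andP[] := JJ _ e0E.
  - by move=> B x BA; apply: Bpos => // e; apply: Jl_le.
move=> x xs; rewrite /Fsum (@wsum_ext J' (Jl (enum E))).
  by apply: step => //; apply/allP => e; rewrite mem_enum.
by move=> e eE _; rewrite /Jl mem_enum eE.
Qed.

(** The energy ignores the spin at [v], and flipping that spin alone cancels the sine part of the
    addition formula. Both sides sum over this spin, so no factor 2 appears. *)
Lemma Fsum_isolated J A v r : v \in A -> (forall e, e \in E -> v \in e -> J e = 0) ->
  F J A r = cos (r * lambda v) * F J (A :\ v) r.
Proof.
move=> vA Jv.
pose fl (s : cfg) : cfg := [ffun u => if u == v then ~~ s u else s u].
have flK : involutive fl.
  by move=> s; apply/ffunP => u; rewrite !ffunE; case: eqP => // _; rewrite negbK.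
have enE s : energy E J A s = energy E J (A :\ v) s.
  rewrite /energy (bigID (fun e : {set V} => e \subset A :\ v)) /= [X in _ + X]big1 ?addr0.
    apply: eq_bigl => e; rewrite -andbA; congr (_ && _).
    by rewrite subsetD1 andbA andbb.
  move=> e /andP[/andP[eE eA]]; rewrite subsetD1 eA negbK => ve.
  by rewrite (Jv e) ?mul0r.
have enf s : energy E J (A :\ v) (fl s) = energy E J (A :\ v) s.
  apply: eq_bigr => e /andP[_]; rewrite subsetD1 => /andP[_ ve]; congr (_ * _).
  by apply: eq_bigr => u ue; rewrite ffunE; case: eqP ue ve => // -> ->.
have magf s : mag (A :\ v) (fl s) = mag (A :\ v) s.
  by apply: eq_bigr => u; rewrite !inE ffunE => /andP[/negbTE ->].
have odd : \sum_s expR (energy E J (A :\ v) s) *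
    (sp (s v) * sin (r * lambda v) * sin (r * mag (A :\ v) s)) = 0.
  set X := \sum_s _; suff : X = - X by lra.
  rewrite {1}/X (reindex_inj (inv_inj flK)) -sumrN; apply: eq_bigr => s _ /=.
  by rewrite enf magf ffunE eqxx spinN; ring.
rewrite /Fsum /wsum mulr_sumr -[RHS]subr0 -[X in _ = _ - X]odd -sumrB; apply: eq_bigr => s _.
rewrite enE (_ : r * mag A s = r * lambda v * sp (s v) + r * mag (A :\ v) s); last first.
  by rewrite /magnetization (big_setD1 v) //=; ring.
rewrite cosD; case: (s v); rewrite /spin ?mulrN1 ?mulr1 ?cosN ?sinN; ring.
Qed.

(** Induction on [#|A|]. First, removing one vertex at the couplings [J] is shown to preserve
    positivity ([posv]); the induction hypothesis then covers all proper sub-volumes, and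
    [positive_upto_couplings] covers [A] itself. *)
Lemma positive_upto_mono J J' A B (s : R) :
  (forall e, e \in E -> 0 <= J' e <= J e) -> B \subset A ->
  positive_upto J A s -> positive_upto J' B s.
Proof.
have [n] := ubnP #|A|; elim: n A B J J' s => // n IH A B J J' s ltn JJ BA pos.
have J0 e : e \in E -> 0 <= J e by move=> /JJ /andP[h /(le_trans h)].
have IHv v s' J'' C : v \in A -> C \subset A :\ v -> positive_upto J (A :\ v) s' ->
    (forall e, e \in E -> 0 <= J'' e <= J e) -> positive_upto J'' C s'.
  move=> vA CA posv J''J; apply: IH posv => //.
  by move: ltn; rewrite (cardsD1 v) vA.
have sub C : C \proper A -> exists2 v, v \in A & C \subset A :\ v.
  by case/properP => CA [v vA vC]; exists v; rewrite // subsetD1 CA.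
have posv v : v \in A -> positive_upto J (A :\ v) s.
  move=> vA x /andP[x0 xs]; rewrite ltNge; apply/negP => Fx.
  (* The earliest zero over all removable vertices: before [t] every one-vertex removal is positive,
     hence by induction every proper sub-volume at smaller couplings. *)
  have [t [w [/andP[t0 tx] wA Fw Fpos]]] := @first_zero_family
    _ _ (fun u => u \in A) _ v x (fun u => @continuous_Fsum J (A :\ u))
    (fun u => Fsum0_gt0 J (A :\ u)) x0 vA Fx.
  (* A zero of the volume without [w] is a zero of [A] with the couplings at [w] switched off. *)
  pose Jw (e : {set V}) := if w \in e then 0 else J e.
  have JwJ e : e \in E -> 0 <= Jw e <= J e.
    by move=> /J0 h; rewrite /Jw; case: ifP => _; rewrite ?h !lexx.
  have : positive_upto Jw A t.
    apply: positive_upto_couplings JwJ _ _ => [C J'' y CA J''J /andP[y0 yt]|y /andP[y0 yt]].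
      have [u uA Cu] := sub _ CA.
      apply: (IHv u y J'' C uA Cu _ J''J); last by rewrite y0 lexx.
      by move=> z /andP[z0 zy]; apply: Fpos; rewrite // z0 (le_lt_trans zy).
    by apply: pos; rewrite y0 (le_trans yt) // (le_trans tx).
  move/(_ t); rewrite t0 lexx => /(_ isT).
  rewrite (@Fsum_isolated _ _ w) //; last by move=> e _ we; rewrite /Jw we.
  rewrite /Fsum (@wsum_ext Jw J).
    by rewrite -/(F J (A :\ w) t) Fw mulr0 ltxx.
  by move=> e _; rewrite subsetD1 /Jw => /andP[_ /negbTE ->].
move: BA; rewrite subEproper => /orP[/eqP ->|/sub[v vA Bv]]; last first.
  exact: (IHv v s J' B vA Bv (posv v vA) JJ).
apply: positive_upto_couplings JJ _ pos => C J'' y /sub[v vA Cv] J''J /andP[y0 ys].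
by apply: (IHv v s J'' C vA Cv (posv v vA) J''J); rewrite y0 ltW.
Qed.

End Monotonicity.

(** * Lee-Yang bound and comparison of the first zeros *)

Section LeeYang.
Variables (R : realType) (V : finType) (E : {set {set V}}) (lambda : V -> R).
Hypothesis E_simple : simple_graph E.
Hypothesis lambda_ge0 : forall u, 0 <= lambda u.
Implicit Types (A : {set V}) (J : {set V} -> R) (x y : R).
Local Notation mag := (magnetization lambda).

(** Together with [mgf_im], the real and imaginary parts of the unnormalized generating function at
    [x + i y]. *)
Definition mgf_re J A x y := wsum E J A (fun s => expR (x * mag A s) * cos (y * mag A s)).
Definition mgf_im J A x y := wsum E J A (fun s => expR (x * mag A s) * sin (y * mag A s)).

Lemma mgf_reN J A x y : mgf_re J A (- x) y = mgf_re J A x y.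
Proof.
rewrite /mgf_re (wsum_flip E_simple); apply: eq_bigr => s _ /=.
by rewrite magnetization_flip mulrNN mulrN cosN.
Qed.

Lemma mgf_imN J A x y : mgf_im J A (- x) y = - mgf_im J A x y.
Proof.
rewrite /mgf_im (wsum_flip E_simple) -sumrN; apply: eq_bigr => s _ /=.
by rewrite magnetization_flip mulrNN mulrN sinN !mulrN.
Qed.

(** In the duplicated form of the squared modulus, the imaginary field couples to [half_sum] and the
    real field to [half_diff]; switching on the latter increases the sum. *)
Lemma Fsum_le_mgf_ge0 J A x y : (forall e, e \in E -> 0 <= J e) -> 0 <= x ->
  Fsum E lambda J A y ^+ 2 <= mgf_re J A x y ^+ 2 + mgf_im J A x y ^+ 2.
Proof.
move=> J0 x0.
have pos : diff_positive (dup_weight E J (cos_test lambda y) A).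
  apply: (diff_positive_weight J0 (cos_test_interior lambda y)) => B _.
  by rewrite (sum_cos_test _ E_simple) sqr_ge0.
have tpos u : u \in A -> 0 <= x * (2 * lambda u) by rewrite !mulr_ge0.
(* The real field acts as an interaction on singletons, compared through the empty monomial. *)
have := diff_positive_exp_sumB (index_enum V) (fun u => [set u]) tpos pos (fun=> 0%N).
under eq_bigr => c _ do rewrite /diff_monomial big1 // mul1r.
rewrite sumrB (sum_cos_test _ E_simple) subr_ge0 => /le_trans; apply.
(* Flipping the second copy turns the complex conjugate field into the same one with [x] negated. *)
have -> : mgf_re J A x y ^+ 2 + mgf_im J A x y ^+ 2 =
    mgf_re J A x y * mgf_re J A (- x) y - mgf_im J A x y * mgf_im J A (- x) y.
  by rewrite mgf_reN mgf_imN; ring.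
rewrite /mgf_re /mgf_im !(wsumM E_simple) -sumrB le_eqVlt; apply/orP; left; apply/eqP.
apply: eq_bigr => c _.
rewrite /dup_weight /cos_test dup_angleE cosD.
have -> : \sum_(u in A) x * (2 * lambda u) * \prod_(v in [set u]) half_diff c v =
    x * mag A (fst_cfg c) + - x * mag A (snd_cfg c).
  rewrite /magnetization !mulr_sumr -big_split; apply: eq_bigr => u _ /=.
  by rewrite big_set1 /half_diff !ffunE; field.
by rewrite expRD; ring.
Qed.

Lemma Fsum_le_mgf J A x y : (forall e, e \in E -> 0 <= J e) ->
  Fsum E lambda J A y ^+ 2 <= mgf_re J A x y ^+ 2 + mgf_im J A x y ^+ 2.
Proof.
move=> J0; have [x0|/ltW x0] := leP 0 x; first exact: Fsum_le_mgf_ge0.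
rewrite -mgf_reN -[X in _ + X]sqrrN -mgf_imN.
by apply: Fsum_le_mgf_ge0; rewrite // oppr_ge0.
Qed.

Lemma ising_mgf_eq0 J x y : (ising_mgf E J lambda (x +i* y)%C == 0) =
  (mgf_re J [set: V] x y == 0) && (mgf_im J [set: V] x y == 0).
Proof.
have Z0 : 0 < ising_Z E J.
  rewrite /ising_Z (bigD1 [ffun=> true]) //= ltr_wpDr ?expR_gt0 //.
  by apply: sumr_ge0 => s _; apply: expR_ge0.
rewrite /ising_mgf mulf_eq0 invr_eq0 orbC.
have -> : ((ising_Z E J)%:C%C == 0) = false.
  by rewrite eq_complex /= gt_eqF.
rewrite /= (_ : \sum_s _ = (mgf_re J [set: V] x y +i* mgf_im J [set: V] x y)%C).
  by rewrite eq_complex.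
rewrite /mgf_re /mgf_im /wsum; elim/big_rec3: _ => // s a b _ _ ->.
have -> : ising_energy E J s = energy E J [set: V] s.
  by apply: eq_bigl => e; rewrite subsetT andbT.
have -> : \sum_u lambda u * spin R (s u) = mag [set: V] s.
  by apply: eq_bigl => u; rewrite inE.
apply/eqP; rewrite eq_complex /= !(mulr0, mul0r, subr0, addr0, add0r).
by rewrite !eqxx.
Qed.

(** The Lee-Yang bound moves the zero [x + i y] to a zero of [Fsum] at [|y|]. By monotonicity [Fsum]
    for [Jt] cannot stay positive up to [|y|], so it vanishes at some [q <= |y|], and [i q] is the
    new zero. *)
Lemma zero_of_larger_couplings J Jt (h : R[i]) :
  (forall e, e \in E -> 0 <= J e <= Jt e) -> ising_mgf E J lambda h = 0 ->
  exists2 h', ising_mgf E Jt lambda h' = 0 & Normc.normc h' <= Normc.normc h.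
Proof.
case: h => x y JJ /eqP; rewrite ising_mgf_eq0 => /andP[/eqP re0 /eqP im0].
have J0 e : e \in E -> 0 <= J e by case/JJ/andP.
have F0 : Fsum E lambda J [set: V] `|y| = 0.
  have := Fsum_le_mgf [set: V] x y J0; rewrite re0 im0 expr0n /= addr0 => F0.
  have {}F0 : Fsum E lambda J [set: V] y = 0.
    by apply/eqP; rewrite -sqrf_eq0 eq_le F0 sqr_ge0.
  by case: (ger0P y) => _; rewrite ?Fsum_even.
have [r /andP[r0 ry] Fr] : exists2 r, 0 <= r <= `|y| & Fsum E lambda Jt [set: V] r <= 0.
  apply: contrapT => no.
  have pos : positive_upto E lambda Jt [set: V] `|y|.
    by move=> r ry; rewrite ltNge; apply/negP => Fr; apply: no; exists r.
  have := positive_upto_mono E_simple lambda_ge0 JJ (subxx _) pos.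
  by move/(_ `|y|); rewrite normr_ge0 lexx F0 ltxx => /(_ isT).
have [q /andP[q0 qr] Fq] := zero_between (@continuous_Fsum _ _ E lambda Jt _) r0
  (ltW (Fsum0_gt0 _ _ _ _)) Fr.
exists (0 +i* q)%C.
  apply/eqP; rewrite ising_mgf_eq0; apply/andP; split; apply/eqP.
    by rewrite -[RHS]Fq; apply: eq_bigr => s _; rewrite mul0r expR0 mul1r.
  apply: (wsum_odd E_simple) => s.
  by rewrite !mul0r expR0 !mul1r magnetization_flip mulrN sinN.
rewrite /= expr0n /= add0r sqrtr_sqr (ger0_norm q0) (le_trans qr) // (le_trans ry) //.
by rewrite -[leLHS]sqrtr_sqr ler_wsqrtr // lerDr sqr_ge0.
Qed.

End LeeYang.

Unset Implicit Arguments.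

Theorem mainTheorem2 (R : realType) (V : finType) (E : {set {set V}})
  (J Jt : {set V} -> R) (lambda : V -> R) :
  simple_graph E ->
  (forall e, e \in E -> 0 <= J e /\ J e <= Jt e) ->
  (forall u, 0 <= lambda u) ->
  (alpha1 E Jt lambda <= alpha1 E J lambda)%E.
Proof.
move=> E_simple JJ lambda_ge0.
have {}JJ e : e \in E -> 0 <= J e <= Jt e by case/JJ => -> ->.
(* Each zero for [J] is bounded below separately; if there is none, the infimum is [+oo]. *)
apply: le_ereal_inf_tmp => _ [h h0 <-].
have [h' h'0 le_h'] := zero_of_larger_couplings E_simple lambda_ge0 JJ h0.
apply: (@le_trans _ _ (Normc.normc h')%:E); last by rewrite lee_fin.
by apply: ereal_inf_lbound; exists h'.
Qed.
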